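(* Let $p$ be a prime and let $k,x\in\mathbb{N}$. Then $$g(p^k,x)=\begin{cases} p^{8(k-1)}\,g(p,0) & \text{if } p\mid x,\\[4pt] \dfrac{p^{8(k-1)}\,\bigl[\,|GL_3(\mathbb{Z}_p)|-g(p,0)\,\bigr]}{p-1} & \text{otherwise.}\end{cases}$$
   Context: $\mathbb{N}$ denotes the positive integers and $\mathbb{Z}_n=\mathbb{Z}/n\mathbb{Z}$. $GL_3(\mathbb{Z}_n)$ is the group of invertible $3\times 3$ matrices over $\mathbb{Z}_n$. For a $3\times 3$ matrix $M=[m_{ij}]$, the permanent is $\mathrm{perm}(M)=\sum_{\sigma\in S_3}\prod_{i=1}^3 m_{i\sigma(i)}$. For a positive integer $n$ and an integer $x$, $g(n,x)$ denotes the cardinality of the set $G(n,x)=\{M\in GL_3(\mathbb{Z}_n)\mid \mathrm{perm}(M)\equiv x \pmod n\}$. *)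

(* Defs.v *)
From mathcomp Require Import all_boot all_order all_fingroup all_algebra.

Set Implicit Arguments.
Unset Strict Implicit.
Unset Printing Implicit Defensive.

Import GRing.Theory.
Local Open Scope ring_scope.

Definition permanent (R : comNzRingType) (m : nat) (M : 'M[R]_m) : R :=
  \sum_(s : 'S_m) \prod_(i < m) M i (s i).

(* The ring 'Z_n is Z/nZ only for n >= 2 ('Z_0 and 'Z_1 both denote Z/2Z), so
   Gset n x and g n x below have their intended meaning for n >= 2 only.  The
   congruence perm(M) = x (mod n) is equality in 'Z_n with the image of x. *)
Definition Gset (n : nat) (x : int) : {set {'GL_3['Z_n]}} :=
  [set M : {'GL_3['Z_n]} | permanent (GLval M) == x%:~R].

Definition g (n : nat) (x : int) : nat := #|Gset n x|.

(* Main.v *)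
(* The permanent is affine in each entry, the coefficient of the (i, j) entry
   being the permanental minor at (i, j).  The key fact is that an invertible
   3 x 3 matrix over a field has a nonzero permanental minor.  Hence, for an
   invertible M over Z/p^k, adding t divided by such a minor to one entry, chosen
   from M mod p only, adds t to the permanent; when p divides t this is a
   bijection of GL_3(Z/p^k), with inverse the same operation for -t.  So
   g(p^k, x) depends only on x mod p, and counting the invertible M with
   perm M = x mod p through the fibres of reduction gives
   g(p^k, x) = p^(8(k-1)) g(p, x) for every x.  Over Z/p, scaling a row shows
   that g(p, x) is the same for all nonzero x. *)
From HB Require Import structures.
Require Import Defs.
From mathcomp Require Import all_boot all_order all_fingroup all_algebra.
From mathcomp Require Import ring.

Set Implicit Arguments.
Unset Strict Implicit.
Unset Printing Implicit Defensive.

Import GRing.Theory.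
Local Open Scope ring_scope.

(** * Permanents and permanental minors *)

Definition permanent_minor (R : comNzRingType) (m : nat) (i j : 'I_m)
    (M : 'M[R]_m) : R :=
  \sum_(s : 'S_m | s i == j) \prod_(k < m | k != i) M k (s k).

Lemma permanent_expand (R : comNzRingType) (m : nat) (i : 'I_m) (M : 'M[R]_m) :
  permanent M = \sum_j M i j * permanent_minor i j M.
Proof.
rewrite /permanent (partition_big (fun s : 'S_m => s i) xpredT) //=.
apply: eq_bigr => j _; rewrite mulr_sumr; apply: eq_bigr => s /eqP sij.
by rewrite (bigD1 i) //= sij.
Qed.

Lemma permanent_minor_eq_row (R : comNzRingType) (m : nat) (i j : 'I_m)
    (M N : 'M[R]_m) :
  (forall a b, a != i -> M a b = N a b) ->
  permanent_minor i j M = permanent_minor i j N.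
Proof.
by move=> eqMN; apply: eq_bigr => s _; apply: eq_bigr => k ki; rewrite eqMN.
Qed.

(** A minor taken at row [i] never reads row [i]. Besides giving affineness, this keeps the divisor
    in [shift_permanent] fixed. *)
Lemma permanent_minor_add_delta (R : comNzRingType) (m : nat)
    (i j l : 'I_m) (c : R) (M : 'M[R]_m) :
  permanent_minor i l (M + c *: delta_mx i j) = permanent_minor i l M.
Proof.
apply: permanent_minor_eq_row => a b /negPf ai.
by rewrite !mxE ai mulr0 addr0.
Qed.

Lemma permanent_add_delta (R : comNzRingType) (m : nat) (i j : 'I_m) (c : R)
    (M : 'M[R]_m) :
  permanent (M + c *: delta_mx i j) = permanent M + c * permanent_minor i j M.
Proof.
rewrite !(permanent_expand i) (bigD1 j) //= [in RHS](bigD1 j) //= permanent_minor_add_delta.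
rewrite !mxE !eqxx mulr1 mulrDl -!addrA [c * _ + _]addrC; congr (_ + (_ + _)).
apply: eq_bigr => l /negPf lj.
by rewrite permanent_minor_add_delta !mxE lj andbF mulr0 addr0.
Qed.

Lemma permanent_map (R S : comNzRingType) (f : {rmorphism R -> S}) (m : nat)
    (M : 'M[R]_m) :
  permanent (map_mx f M) = f (permanent M).
Proof.
rewrite /permanent rmorph_sum; apply: eq_bigr => s _; rewrite rmorph_prod.
by apply: eq_bigr => i _; rewrite mxE.
Qed.

Lemma permanent_minor_map (R S : comNzRingType) (f : {rmorphism R -> S})
    (m : nat) (i j : 'I_m) (M : 'M[R]_m) :
  permanent_minor i j (map_mx f M) = f (permanent_minor i j M).
Proof.
rewrite /permanent_minor rmorph_sum; apply: eq_bigr => s _; rewrite rmorph_prod.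
by apply: eq_bigr => k _; rewrite mxE.
Qed.

Lemma permanent_char2 (R : comNzRingType) (m : nat) (M : 'M[R]_m) :
  2%:R = 0 :> R -> permanent M = \det M.
Proof.
move=> two0; apply: eq_bigr => s _.
have -> : (-1 : R) = 1.
  by apply/eqP; rewrite eq_sym -subr_eq0 opprK -two0.
by rewrite expr1n mul1r.
Qed.

(** * Permanental minors of 3 x 3 matrices *)

Lemma ord3_cover (i a b k : 'I_3) :
  i != a -> i != b -> a != b -> [\/ k = i, k = a | k = b].
Proof.
move=> ia ib ab; case: (eqVneq k i) => [|ki]; first by constructor 1.
case: (eqVneq k a) => [|ka]; first by constructor 2.
case: (eqVneq k b) => [|kb]; first by constructor 3.
have : uniq [:: k; i; a; b] by rewrite /= !inE !negb_or ki ka kb ia ib ab.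
by move=> /card_uniqP card4; have := max_card (mem [:: k; i; a; b]); rewrite card4 card_ord.
Qed.

Lemma permanent_minor3 (R : comNzRingType) (M : 'M[R]_3) (i a b j c d : 'I_3) :
  i != a -> i != b -> a != b -> j != c -> j != d -> c != d ->
  permanent_minor i j M = M a c * M b d + M a d * M b c.
Proof.
move=> ia ib ab jc jd cd.
(* Exactly two permutations send [i] to [j]: one sends [a], [b] to [c], [d], the other to [d],
   [c]. *)
pose h c' d' k := if k == i then j else if k == a then c' else d'.
have h_inj c' d' : j != c' -> j != d' -> c' != d' -> injective (h c' d').
  move=> jc' jd' cd' k l; rewrite /h.
  case: (ord3_cover k ia ib ab) => ->; case: (ord3_cover l ia ib ab) => -> //;
  rewrite ?eqxx ?(eq_sym a i) ?(eq_sym b i) ?(eq_sym b a)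
          ?(negPf ia) ?(negPf ib) ?(negPf ab) // => /eqP;
  by rewrite ?(eq_sym c' j) ?(eq_sym d' j) ?(eq_sym d' c')
             ?(negPf jc') ?(negPf jd') ?(negPf cd').
have dc : d != c by rewrite eq_sym.
pose s0 := perm (h_inj c d jc jd cd); pose s1 := perm (h_inj d c jd jc dc).
have s0i : s0 i = j by rewrite permE /h eqxx.
have s0a : s0 a = c by rewrite permE /h eqxx eq_sym (negPf ia).
have s0b : s0 b = d by rewrite permE /h eq_sym (negPf ib) eq_sym (negPf ab).
have s1i : s1 i = j by rewrite permE /h eqxx.
have s1a : s1 a = d by rewrite permE /h eqxx eq_sym (negPf ia).
have s1b : s1 b = c by rewrite permE /h eq_sym (negPf ib) eq_sym (negPf ab).
have s10 : s1 != s0.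
  by apply/eqP => /permP /(_ a) /eqP; rewrite s1a s0a (negPf dc).
have prodE (s : 'S_3) : \prod_(k < 3 | k != i) M k (s k) = M a (s a) * M b (s b).
  rewrite (bigD1 a) 1?eq_sym //= (bigD1 b) /=; last by rewrite eq_sym ib eq_sym ab.
  rewrite big1 ?mulr1 // => k /andP[/andP[ki ka] kb].
  by case: (ord3_cover k ia ib ab) ki ka kb => ->; rewrite eqxx.
rewrite /permanent_minor (bigD1 s0) ?s0i //= (bigD1 s1) /=; last by rewrite s1i eqxx.
rewrite [X in _ + (_ + X)]big1 ?addr0 ?prodE ?s0a ?s0b ?s1a ?s1b //.
move=> s /andP[/andP[/eqP si ss0] ss1].
have eqs (s' : 'S_3) : s' i = j -> s a = s' a -> s b = s' b -> s = s'.
  move=> e1 e2 e3; apply/permP => k.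
  by case: (ord3_cover k ia ib ab) => ->; rewrite ?si ?e1 ?e2 ?e3.
have saj : s a != j by rewrite -si (inj_eq perm_inj) eq_sym.
have sbj : s b != j by rewrite -si (inj_eq perm_inj) eq_sym.
have sab : s a != s b by rewrite (inj_eq perm_inj).
have [sj|sc|sd] := ord3_cover (s a) jc jd cd.
- by rewrite sj eqxx in saj.
- have [tj|tc|td] := ord3_cover (s b) jc jd cd.
  + by rewrite tj eqxx in sbj.
  + by rewrite sc tc eqxx in sab.
  + by rewrite (eqs s0) ?eqxx // ?s0a ?s0b in ss0.
- have [tj|tc|td] := ord3_cover (s b) jc jd cd.
  + by rewrite tj eqxx in sbj.
  + by rewrite (eqs s1) ?eqxx // ?s1a ?s1b in ss1.
  + by rewrite sd td eqxx in sab.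
Qed.

Lemma det_row0 (R : comNzRingType) (m : nat) (i : 'I_m) (M : 'M[R]_m) :
  (forall j, M i j = 0) -> \det M = 0.
Proof.
by move=> Mi0; rewrite (expand_det_row _ i) big1 // => j _; rewrite Mi0 mul0r.
Qed.

Lemma det_col0 (R : comNzRingType) (m : nat) (j : 'I_m) (M : 'M[R]_m) :
  (forall i, M i j = 0) -> \det M = 0.
Proof. by move=> M0; rewrite -det_tr (det_row0 (i := j)) // => i; rewrite mxE. Qed.

(** Being a field is expressed by invertibility of nonzero elements, so that the lemma applies
    directly to ['Z_p]. *)
Lemma det_permanent_minors0 (F : comUnitRingType) (M : 'M[F]_3) :
  (forall a : F, a != 0 -> a \is a GRing.unit) ->
  (forall i j, permanent_minor i j M = 0) -> \det M = 0.
Proof.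
move=> unitF minor0.
have mul0 (a b : F) : a != 0 -> a * b = 0 -> b = 0.
  by move=> /unitF ua ab; apply: (mulrI ua); rewrite mulr0.
(* In characteristic 2 the permanent is the determinant.  Otherwise the first
   row decides: if it has no zero entry then the second row vanishes; if it has
   both zero and nonzero entries then the column of a zero entry vanishes. *)
have [two0|two_neq0] := eqVneq (2%:R : F) 0.
  rewrite -permanent_char2 // (permanent_expand ord0) big1 // => j _.
  by rewrite minor0 mulr0.
have third (u v : 'I_3) : u != v -> exists w, (w != u) && (w != v).
  by case: u => [[|[|[|//]]] ?]; case: v => [[|[|[|//]]] ?] //= _;
     first [by exists 0 | by exists 1 | by exists ord_max].
(* The relation is the vanishing of the minor at the remaining row and the remaining column. *)
have rel a u v : a != 0 -> u != v -> M 0 u * M a v + M 0 v * M a u = 0.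
  move=> a0 uv; have [i /andP[i0 ia]] := third 0 a (ltac:(by rewrite eq_sym)).
  have [j /andP[ju jv]] := third u v uv.
  by rewrite -(minor0 i j); apply/esym/permanent_minor3; rewrite // eq_sym.
have [/forallP row_neq0|] := boolP [forall u, M 0 u != 0].
  apply: (det_row0 (i := 1)) => w.
  have [v vw] : exists v, v != w by exists (w + 1); case: w => [[|[|[|//]]] ?].
  have [u /andP[uv uw]] := third v w vw.
  apply: (mul0 _ _ (row_neq0 u)); apply: (mul0 _ _ (row_neq0 v)).
  apply: (mul0 _ _ two_neq0).
  have := rel 1 u v isT uv; have := rel 1 u w isT uw; have := rel 1 v w isT vw.
  move=> e1 e2 e3.
  (* In this combination of the three relations only [2 * M 0 u * M 0 v * M 1 w] survives. *)
  transitivity (M 0 v * (M 0 u * M 1 w + M 0 w * M 1 u)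
    + M 0 u * (M 0 v * M 1 w + M 0 w * M 1 v)
    - M 0 w * (M 0 u * M 1 v + M 0 v * M 1 u)); first by ring.
  by rewrite e1 e2 e3; ring.
rewrite negb_forall => /existsP[e /negPn/eqP Me].
have [/existsP[c Mc]|/existsPn row0] := boolP [exists u, M 0 u != 0]; last first.
  by apply: (det_row0 (i := 0)) => u; apply/eqP/negPn/row0.
apply: (det_col0 (j := e)) => a; have [->//|a0] := eqVneq a 0.
apply: (mul0 _ _ Mc); have ce : c != e by apply: contraNneq Mc => ->; rewrite Me.
by have := rel a c e a0 ce; rewrite Me mul0r addr0.
Qed.

(** * Counting by fibres and by scaling *)

(** All fibres are translates of the kernel, hence equally large; the product form avoids
    division. *)
Lemma card_preim_additive (A B : finZmodType) (f : {additive A -> B})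
    (P : pred B) :
  (forall b, exists a, f a = b) ->
  (#|[set a | P (f a)]| * #|B| = #|[set b | P b]| * #|A|)%N.
Proof.
move=> f_surj.
have fiber b : #|[set a | f a == b]| = #|[set a | f a == 0]|.
  have [a0 fa0] := f_surj b.
  rewrite -(card_imset [set a | f a == 0] (addrI a0)); apply: eq_card => a.
  rewrite inE; apply/eqP/imsetP => [fa|[c]].
    by exists (a - a0); rewrite ?inE ?raddfB ?fa ?fa0 ?subrr //= addrC subrK.
  by rewrite inE => /eqP fc ->; rewrite raddfD /= fa0 fc addr0.
have cardE (Q : pred B) :
    #|[set a | Q (f a)]| = (#|[set b | Q b]| * #|[set a | f a == 0%R]|)%N.
  rewrite -sum1_card (partition_big f Q) /=; last by move=> a; rewrite inE.
  rewrite -sum_nat_const; apply: congr_big => // [b|b Qb]; first by rewrite inE.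
  rewrite sum1dep_card -(fiber b); apply: eq_card => a; rewrite !inE.
  by case: eqP => [->|]; rewrite ?andbT ?andbF.
have cardA : #|A| = (#|B| * #|[set a | f a == 0%R]|)%N.
  by rewrite -(cardsT A) -(cardsT B); exact: (cardE xpredT).
by rewrite cardE cardA -mulnA [(#|B| * _)%N]mulnC.
Qed.

Definition unitmx_permanent (R : finComUnitRingType) (x : R) : {set 'M[R]_3} :=
  [set M | (M \in unitmx) && (permanent M == x)].

(** Multiplication by the diagonal matrix with entries [v], 1, 1 is injective, keeps invertibility
    and scales the permanent by [v]. Taking [v] to be [u] and then its inverse gives both
    inequalities. *)
Lemma card_unitmx_permanent_scale (R : finComUnitRingType) (u x : R) :
  u \is a GRing.unit -> #|unitmx_permanent (u * x)| = #|unitmx_permanent x|.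
Proof.
have le_scale (v y : R) : v \is a GRing.unit ->
    (#|unitmx_permanent y| <= #|unitmx_permanent (v * y)%R|)%N.
  move=> uv; pose D : 'M[R]_3 := diag_mx (\row_(i < 3) (if i == 0 then v else 1)).
  have uD : D \in unitmx.
    by rewrite unitmxE det_diag !big_ord_recl big_ord0 !mxE /= !mulr1.
  rewrite -(card_imset (unitmx_permanent y) (can_inj (mulKmx uD))).
  apply: subset_leq_card; apply/subsetP => _ /imsetP[M + ->].
  rewrite !inE => /andP[uM /eqP <-]; rewrite unitmx_mul uD uM /=.
  apply/eqP; rewrite mulr_sumr; apply: eq_bigr => s _.
  under eq_bigr => i _ do rewrite mul_diag_mx !mxE.
  by rewrite big_split /= !big_ord_recl !big_ord0 /= !mulr1.
move=> uu; apply/eqP; rewrite eqn_leq le_scale // andbT.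
by rewrite -{2}(mulKr uu x) le_scale ?unitrV.
Qed.

(** Sorting by the value of the permanent, the class of each nonzero [y] is as large as that of [x],
    by scaling with the unit [y / x]. *)
Lemma card_unitmx_permanent_field (F : finComUnitRingType) (x : F) :
  (forall a : F, a != 0 -> a \is a GRing.unit) -> x != 0 ->
  (#|[set M : 'M[F]_3 | M \in unitmx]| =
     #|unitmx_permanent (0 : F)%R| + #|F|.-1 * #|unitmx_permanent x|)%N.
Proof.
move=> unitF x0; rewrite -sum1dep_card (partition_big (@permanent F 3) xpredT) //=.
rewrite (bigD1 0) //= sum1dep_card; congr (_ + _)%N.
rewrite -(cardC1 (0 : F)) -sum_nat_const; apply: eq_bigr => y y0.
rewrite sum1dep_card -(mulrVK (unitF _ x0) y) card_unitmx_permanent_scale //.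
by rewrite unitrM unitrV !unitF.
Qed.

(** * Lifting the count from the residue field *)

(* The hypotheses say that R is local with residue field F. *)
Section Lift.

Variables (R F : finComUnitRingType) (f : {rmorphism R -> F}).
Hypothesis unitF : forall a : F, a != 0 -> a \is a GRing.unit.
Hypothesis f_unit : forall a, (f a \is a GRing.unit) = (a \is a GRing.unit).
Hypothesis f_surj : forall b, exists a, f a = b.

Lemma unitmx_map_local (m : nat) (M : 'M[R]_m) :
  (map_mx f M \in unitmx) = (M \in unitmx).
Proof. by rewrite !unitmxE det_map_mx f_unit. Qed.

Definition minor_pos (N : 'M[F]_3) : 'I_3 * 'I_3 :=
  odflt (0, 0) [pick ij | permanent_minor ij.1 ij.2 N != 0].

Lemma minor_pos_neq0 (N : 'M[F]_3) : N \in unitmx ->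
  permanent_minor (minor_pos N).1 (minor_pos N).2 N != 0.
Proof.
move=> uN; rewrite /minor_pos; case: pickP => //= all0.
move: uN; rewrite unitmxE (det_permanent_minors0 unitF) ?unitr0 // => i j.
by apply/eqP; apply/negPn; rewrite (all0 (i, j)).
Qed.

Definition shift_permanent (t : R) (M : 'M[R]_3) : 'M[R]_3 :=
  let: (i, j) := minor_pos (map_mx f M) in
  M + (t / permanent_minor i j M) *: delta_mx i j.

Lemma map_shift_permanent (t : R) (M : 'M[R]_3) :
  f t = 0 -> map_mx f (shift_permanent t M) = map_mx f M.
Proof.
move=> ft; rewrite /shift_permanent; case: minor_pos => i j.
by apply/matrixP => a b; rewrite !mxE !rmorphD !rmorphM /= ft !mul0r addr0.
Qed.

(** The shift changes neither the chosen position nor the minor there, so the two added terms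
    cancel, whether or not that minor is a unit. *)
Lemma shift_permanentK (t : R) :
  f t = 0 -> cancel (shift_permanent t) (shift_permanent (- t)).
Proof.
move=> ft M; rewrite {1}/shift_permanent map_shift_permanent // /shift_permanent.
case: minor_pos => i j.
by rewrite permanent_minor_add_delta -addrA -scalerDl mulNr subrr scale0r addr0.
Qed.

Lemma permanent_shift_permanent (t : R) (M : 'M[R]_3) : M \in unitmx ->
  permanent (shift_permanent t M) = permanent M + t.
Proof.
rewrite -unitmx_map_local => /minor_pos_neq0 /unitF; rewrite /shift_permanent.
case: minor_pos => i j /=; rewrite permanent_minor_map f_unit => um.
by rewrite permanent_add_delta divrK.
Qed.

Lemma card_unitmx_permanent_eq (x y : R) :
  f x = f y -> #|unitmx_permanent x| = #|unitmx_permanent y|.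
Proof.
have le_shift (a b : R) : f a = f b ->
    (#|unitmx_permanent a| <= #|unitmx_permanent b|)%N.
  move=> fab; have ft : f (b - a) = 0 by rewrite rmorphB fab subrr.
  rewrite -(card_imset (unitmx_permanent a) (can_inj (shift_permanentK ft))).
  apply: subset_leq_card; apply/subsetP => _ /imsetP[M + ->].
  rewrite !inE => /andP[uM /eqP pM]; rewrite permanent_shift_permanent // pM.
  by rewrite -unitmx_map_local map_shift_permanent // unitmx_map_local uM addrC subrK /=.
by move=> fxy; apply/eqP; rewrite eqn_leq !le_shift.
Qed.

(** The set [B] is counted twice: through the fibres of reduction on the 9 entries, and by the value
    of the permanent, which splits it into [#|A|] classes of equal size. Since [#|A|] is [#|R|] over
    [#|F|], one of the 9 factors cancels. *)
Lemma card_unitmx_permanent_lift (x : R) :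
  (#|unitmx_permanent x| * #|F| ^ 8 = #|unitmx_permanent (f x)| * #|R| ^ 8)%N.
Proof.
have R_gt0 : (0 < #|R|)%N by apply/card_gt0P; exists 0.
have F_gt0 : (0 < #|F|)%N by apply/card_gt0P; exists 0.
have map_surj (N : 'M[F]_3) : exists M, map_mx f M = N.
  have ex i j : exists a, f a == N i j.
    by have [a <-] := f_surj (N i j); exists a.
  exists (\matrix_(i, j) xchoose (ex i j)); apply/matrixP => i j.
  by rewrite !mxE; apply/eqP/(xchooseP (ex i j)).
pose A := [set a | f a == f x].
pose B := [set M : 'M[R]_3 | (map_mx f M \in unitmx)
                             && (permanent (map_mx f M) == f x)].
have sizeM : (#|B| * #|F| ^ 9 = #|unitmx_permanent (f x)| * #|R| ^ 9)%N.
  have := card_preim_additive (f := map_mx f)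
    (fun N => (N \in unitmx) && (permanent N == f x)) map_surj.
  by rewrite !card_mx.
have sizeR : (#|A| * #|F| = #|R|)%N.
  have := card_preim_additive (f := f) (pred1 (f x)) f_surj.
  rewrite (_ : #|[set b | pred1 (f x) b]| = 1)%N ?mul1n //.
  by rewrite -[RHS](cards1 (f x)); apply: eq_card => b; rewrite !inE.
have countM : #|B| = (#|A| * #|unitmx_permanent x|)%N.
  rewrite -[LHS]sum1dep_card.
  rewrite (partition_big (@permanent R 3) (fun a => f a == f x)) /=; last first.
    by move=> M /andP[_]; rewrite permanent_map.
  rewrite -sum_nat_const; apply: congr_big => // [a|a /eqP fa]; first by rewrite inE.
  rewrite sum1dep_card -(card_unitmx_permanent_eq fa); apply: eq_card => M.
  rewrite !inE unitmx_map_local permanent_map -andbA; congr (_ && _).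
  by case: (eqVneq (permanent M) a) => [->|]; rewrite ?fa ?eqxx ?andbF.
(* Both sides are multiplied by [#|R|], written on the left as [#|A| * #|F|]; this brings the
   exponents back to 9. *)
apply/eqP; rewrite -(eqn_pmul2r R_gt0) -[X in (_ * X == _)%N]sizeR.
by rewrite mulnACA -[X in (X * _)%N]mulnC -countM -expnSr sizeM -mulnA -expnSr.
Qed.

End Lift.

(** * Residue rings of the integers and the final count *)

(** Mere existence suffices, because every ring morphism sends [n%:R] to [n%:R] and these are all
    the elements of ['Z_m]. *)
Lemma Zp_reduction (m p : nat) : (1 < m)%N -> (1 < p)%N -> (p %| m)%N ->
  inhabited {rmorphism 'Z_m -> 'Z_p}.
Proof.
move=> m1 p1 pm; pose f (a : 'Z_m) : 'Z_p := (a : nat)%:R.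
have f_nat n : f n%:R = n%:R.
  by apply: val_inj; rewrite /f /= !val_Zp_nat // modn_dvdm.
have fD : {morph f : a b / a + b}.
  by move=> a b; rewrite -(natr_Zp a) -(natr_Zp b) -natrD !f_nat natrD.
have fM : monoid_morphism f.
  split; first exact: (f_nat 1%N).
  by move=> a b; rewrite -(natr_Zp a) -(natr_Zp b) -natrM !f_nat natrM.
have fB : zmod_morphism f.
  by move=> a b; apply/(addIr (f b)); rewrite -fD !subrK.
pose fBm := GRing.isZmodMorphism.Build _ _ f fB.
pose fMm := GRing.isMonoidMorphism.Build _ _ f fM.
exact: (inhabits (HB.pack f fBm fMm : {rmorphism 'Z_m -> 'Z_p})).
Qed.

Lemma card_GL3E (R : finComUnitRingType) (P : pred 'M[R]_3) :
  #|[set M : {'GL_3[R]} | P (GLval M)]|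
    = #|[set M : 'M[R]_3 | (M \in unitmx) && P M]|.
Proof.
rewrite -(card_imset _ (val_inj : injective (@GLval 3 R))).
apply: eq_card => M; rewrite !inE; apply/imsetP/andP => [[u + ->]|[uM PM]].
  by rewrite inE => ?; split=> //; exact: (valP u).
by exists (Sub M uM : {'GL_3[R]}); rewrite ?inE ?SubK.
Qed.

Lemma gE (n : nat) (x : int) : g n x = #|unitmx_permanent (x%:~R : 'Z_n)|.
Proof. exact: (card_GL3E (fun M => permanent M == x%:~R)). Qed.

Unset Implicit Arguments.

Theorem theorem1 (p k x : nat) (p_prime : prime p)
    (k_gt0 : (0 < k)%N) (x_gt0 : (0 < x)%N) :
  (g (p ^ k) x%:Z)%:R =
    (if (p %| x)%N then
       p%:R ^+ (8 * (k - 1)) * (g p 0)%:R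
     else
       p%:R ^+ (8 * (k - 1)) * (#|'GL_3['Z_p]%g|%:R - (g p 0)%:R) / (p%:R - 1))
    :> rat.
Proof.
have p1 := prime_gt1 p_prime; have p0 := prime_gt0 p_prime.
have pk1 : (1 < p ^ k)%N by rewrite -(exp1n k) ltn_exp2r.
have [f] := Zp_reduction pk1 p1 (dvdn_exp k_gt0 (dvdnn p)).
have unitF (a : 'Z_p) : a != 0 -> a \is a GRing.unit.
  rewrite -(natr_Zp a) unitZpE // prime_coprime //; apply: contraNN => pa.
  by apply/eqP/val_inj; rewrite /= val_Zp_nat //; apply/eqP.
(* Units on both sides are the classes of integers prime to [p]. *)
have f_unit (a : 'Z_(p ^ k)) : (f a \is a GRing.unit) = (a \is a GRing.unit).
  by rewrite -(natr_Zp a) rmorph_nat !unitZpE // coprime_pexpl.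
have f_surj b : exists a, f a = b by exists (b : nat)%:R; rewrite rmorph_nat natr_Zp.
have cardZ n : (1 < n)%N -> #|'Z_n| = n by move=> n1; rewrite card_ord Zp_cast.
have lift : g (p ^ k) x%:Z = (p ^ (8 * (k - 1)) * g p x%:Z)%N.
  have := card_unitmx_permanent_lift unitF f_unit f_surj x%:R.
  rewrite !gE -!pmulrn rmorph_nat !cardZ // => e.
  have p8 : (0 < p ^ 8)%N by rewrite expn_gt0 p0.
  (* After multiplication by [p ^ 8] the exponents agree, as [8 * (k - 1) + 8 = 8 * k] for positive
     [k]. *)
  apply/eqP; rewrite -(eqn_pmul2r p8) e mulnAC -expnD -expnM mulnC; apply/eqP.
  by congr (p ^ _ * _)%N; rewrite addnC -mulnS subn1 prednK // mulnC.
rewrite lift natrM natrX; have [px|npx] := boolP (p %| x)%N.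
  congr (_ * _%:R); rewrite !gE; congr #|unitmx_permanent _|.
  by apply: val_inj; rewrite -pmulrn /= val_Zp_nat //; apply/eqP.
have x0 : (x%:~R : 'Z_p) != 0.
  by rewrite -pmulrn; apply: contra npx => /eqP/(congr1 val) /=; rewrite val_Zp_nat // => /eqP.
(* Since the [p - 1] nonzero values of the permanent are equally frequent, the division in the
   statement is exact. *)
have -> : #|'GL_3['Z_p]%g| = (g p 0 + p.-1 * g p x%:Z)%N.
  have := card_unitmx_permanent_field unitF x0.
  rewrite cardZ // !gE mulr0z => <-.
  rewrite -[LHS]/#|[set M : {'GL_3['Z_p]} | xpredT (GLval M)]| card_GL3E.
  by apply: eq_card => M; rewrite !inE andbT.
have p1_neq0 : p%:R - 1 != 0 :> rat by rewrite subr_eq0 Num.Theory.pnatr_eq1 gtn_eqF.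
rewrite natrD natrM -subn1 natrB // addrC addrA addNr add0r.
by rewrite [(_ - 1) * _]mulrC mulrA mulfK.
Qed.
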